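(* Let $X$ be a regular $T_1$ topological space. The following statements are equivalent. (1) $(\mathcal{K}(X),\tau_V)$ is an open compact-covering image of a metric space. (2) $(\mathcal{K}(X),\tau_V)$ is a $D_0$-space. (3) $(\mathcal{F}(X),\tau_V)$ is a $D_0$-space. (4) $(\mathcal{F}_2(X),\tau_V)$ is a $D_0$-space. (5) $X$ is a $D_0$-space and every compact subset of $X$ is metrizable.
   Context: $CL(X)$ is the set of all nonempty closed subsets of $X$; $\mathcal{K}(X)$ is the set of all nonempty compact subsets of $X$; $\mathcal{F}(X)$ is the set of all nonempty finite subsets of $X$; $\mathcal{F}_2(X)=\{A\subset X: A\neq\emptyset, |A|\leq 2\}$. The Vietoris topology $\tau_V$ on $CL(X)$ is generated by the sets $\langle U_1,\ldots,U_k\rangle=\{H\in CL(X): H\subset\bigcup_{i=1}^k U_i,\ H\cap U_j\neq\emptyset \text{ for } 1\leq j\leq k\}$, where $k\in\mathbb{N}$ and $U_1,\ldots,U_k$ are open in $X$. On subsets of $CL(X)$, $\tau_V$ denotes the subspace topology. A space $Y$ is a $D_0$-space if every compact subset $A$ of $Y$ has a countable local base, i.e. there is a countable family of open sets containing $A$ such that every open set containing $A$ contains a member of the family. A continuous map $f:M\to Y$ is compact-covering if each compact subset of $Y$ is the image under $f$ of some compact subset of $M$. $Y$ is an open compact-covering image of a metric space if there are a metric space $M$ and a continuous, open, compact-covering map from $M$ onto $Y$. *)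

(* Defs.v *)
From HB Require Import structures.
From mathcomp Require Import all_boot all_order all_algebra.
From mathcomp Require Import boolp classical_sets functions cardinality reals.
From mathcomp Require Import topology.

Set Implicit Arguments.
Unset Strict Implicit.
Unset Printing Implicit Defensive.

Local Open Scope classical_set_scope.
Local Open Scope card_scope.

Record closed_hyperspace (X : topologicalType) := ClosedHyperspace {
  hyperset :> set X;
  hyperset_closed : closed hyperset;
  hyperset_nonempty : hyperset !=set0
}.

HB.instance Definition _ (X : topologicalType) :=
  gen_eqMixin (closed_hyperspace X).
HB.instance Definition _ (X : topologicalType) :=
  gen_choiceMixin (closed_hyperspace X).

HB.instance Definition _ (T : choiceType) := isPointed.Build (seq T) [::].

Section Vietoris.
Variable X : topologicalType.
Notation CL := (closed_hyperspace X).

(* For Us = [:: U_1; ...; U_k] this is the basic set <U_1, ..., U_k>; the case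
   k = 0 is harmless, as it yields set0 *)
Definition vietoris_base (Us : seq (set X)) : set CL :=
  [set H | H `<=` \bigcup_(U in [set` Us]) U /\
           forall U, U \in Us -> H `&` U !=set0].

Definition open_seq : set (seq (set X)) :=
  [set Us | forall U, U \in Us -> open U].

Lemma vietoris_base_cover :
  \bigcup_(Us in open_seq) vietoris_base Us = setT.
Proof.
apply/seteqP; split=> // H _.
exists [:: setT].
  by move=> U; rewrite inE => /eqP ->; exact: openT.
split; first by move=> x _; exists setT => //=; rewrite inE.
move=> U; rewrite inE => /eqP ->; rewrite setIT.
exact: hyperset_nonempty.
Qed.

Lemma vietoris_base_join (Us Vs : seq (set X)) (H : CL) :
  open_seq Us -> open_seq Vs -> vietoris_base Us H -> vietoris_base Vs H ->
  exists Ws, [/\ open_seq Ws, vietoris_base Ws H &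
    vietoris_base Ws `<=` vietoris_base Us `&` vietoris_base Vs].
Proof.
move=> oU oV [HU UH] [HV VH].
pose u := \bigcup_(U in [set` Us]) U; pose v := \bigcup_(V in [set` Vs]) V.
have ou : open u by apply: bigcup_open => U /= /oU.
have ov : open v by apply: bigcup_open => V /= /oV.
exists ([seq U `&` v | U <- Us] ++ [seq u `&` V | V <- Vs]); split.
- move=> W; rewrite mem_cat => /orP[] /mapP[Z ZU ->]; apply: openI => //.
  + exact: oU.
  + exact: oV.
- split.
    move=> x Hx; have [U /= UU Ux] := HU _ Hx.
    exists (U `&` v); last by split => //; exact: HV.
    by rewrite /= mem_cat (map_f (fun U => U `&` v)).
  move=> W; rewrite mem_cat => /orP[] /mapP[Z ZU ->].
    by have [x [Hx Zx]] := UH _ ZU; exists x; split => //; split => //; exact: HV.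
  by have [x [Hx Zx]] := VH _ ZU; exists x; split => //; split => //; exact: HU.
- move=> K [KW WK].
  have Kuv : K `<=` u `&` v.
    move=> x /KW[W /=]; rewrite mem_cat => /orP[] /mapP[Z ZU ->] [? ?]; split=> //.
      by exists Z.
    by exists Z.
  split; split.
  + by move=> x /Kuv[].
  + move=> U UU; have [|x [Kx [Ux _]]] := WK (U `&` v).
      by rewrite mem_cat (map_f (fun U => U `&` v)).
    by exists x.
  + by move=> x /Kuv[].
  + move=> V VV; have [|x [Kx [_ Vx]]] := WK (u `&` V).
      by rewrite mem_cat (map_f (fun V => u `&` V)) ?orbT.
    by exists x.
Qed.

HB.instance Definition _ := @isBaseTopological.Build CL
  (seq (set X)) open_seq vietoris_base vietoris_base_cover vietoris_base_join.

(* These are subsets of CL, so K(X) and F(X) have their usual meaning when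
   compact, resp. finite, sets are closed, which holds for X regular and T1.
   Used as types, they carry the subspace topology of CL. *)
Definition compact_hyperspace : set CL := [set H | compact H].

Definition finite_hyperspace : set CL := [set H | finite_set H].

Definition hyperspace2 : set CL := [set H | H #<= `I_2].

End Vietoris.

Arguments compact_hyperspace : clear implicits.
Arguments finite_hyperspace : clear implicits.
Arguments hyperspace2 : clear implicits.

Definition D0_space (Y : topologicalType) : Prop :=
  forall A : set Y, compact A ->
  exists B : set (set Y), [/\ countable B,
    forall V, B V -> open V /\ A `<=` V &
    forall U, open U -> A `<=` U -> exists2 V, B V & V `<=` U].

Definition open_map (S T : topologicalType) (f : S -> T) : Prop :=
  forall U : set S, open U -> open (f @` U).

Definition compact_covering (S T : topologicalType) (f : S -> T) : Prop :=
  forall C : set T, compact C -> exists2 K : set S, compact K & f @` K = C.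

Definition open_compact_covering_metric_image (R : realType)
    (Y : topologicalType) : Prop :=
  exists (M : metricType R) (f : M -> Y),
    [/\ continuous f, open_map f, compact_covering f &
        set_surj [set: M] [set: Y] f].

Definition metrizable (R : realType) (Y : topologicalType) : Prop :=
  exists (M : metricType R) (f : Y -> M) (g : M -> Y),
    [/\ continuous f, continuous g, cancel f g & cancel g f].

(* Main.v *)
Require Import Defs.
From HB Require Import structures.
From mathcomp Require Import all_boot all_order all_algebra.
From mathcomp Require Import boolp classical_sets functions cardinality reals.
From mathcomp Require Import interval_inference topology num_normedtype urysohn.

Set Implicit Arguments.
Unset Strict Implicit.
Unset Printing Implicit Defensive.

Import Order.TTheory GRing.Theory Num.Theory.

Local Open Scope classical_set_scope.

(** Each statement of the list implies the next one, and the last implies the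
    first.

    From a metric image to [D0]: if [f : M -> Y] is open and compact-covering
    with [M] metric, and [f] maps the compact set [K] onto [A], the images
    under [f] of the [1/(n+1)]-neighbourhoods of [K] form a countable base at
    [A] ([D0_compact_covering_image]).

    From [K(X)] to [F(X)] to [F_2(X)]: the [D0] property passes to subspaces
    ([D0_subset]).

    From [F_2(X)] to [X]: [x |-> {x}] embeds [X] in [F_2(X)], so [X] is [D0].
    For [A] compact in [X], the singletons of points of [A] form a compact
    subset of [F_2(X)]; pulling back a countable base at it along [(x, y) |->
    {x, y}] gives a countable base at the diagonal of [A * A].  On a compact
    Hausdorff space the neighbourhoods of the diagonal are the entourages of a
    uniformity, so that uniformity has a countable base and [A] is metrizable
    ([D0_hyperspace2_metrizable]).

    From [X] to a metric image: call a sequence of open sets an outer base of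
    [A] if it contains a neighbourhood base at every point of [A].  Every
    compact [A] in [X] has one: if [G_n] is a countable network of the
    metrizable compact [A], take together countable bases at the compact sets
    made of the points of [A] in the closure of [G_n]
    ([D0_compact_outer_base]).  Compact subsets of [K(X)] inherit this, since
    their union is compact in [X] ([compact_hyperspace_outer_base]).  Finally,
    a Hausdorff space [Y] all of whose compact sets have outer bases is an
    open compact-covering image of the metrizable space of all sequences of
    open sets of [Y] that form a neighbourhood base at some point, each
    sequence being sent to that point; two such sequences are close when they
    agree on a long initial segment
    ([outer_base_open_compact_covering_image]).  *)

(** * Compactness and separation *)

Section Compactness.
Variable T : topologicalType.
Implicit Types (A K O : set T) (F : set (set T)).

(** Unlike [compact_cover], this lemma and the next one need no distinguished
    point of [T], which may be empty. *)
Lemma compact_directed_cover A F : compact A ->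
    (forall O, F O -> open O) -> F set0 -> setU_closed F ->
    (forall x, A x -> exists2 O, F O & O x) ->
  exists2 O, F O & A `<=` O.
Proof.
(* apply the covering form of compactness along the filter on [set T]
   generated by the final segments of [F] *)
move=> /compact_near_coveringP cA Fo F0 FU AF.
pose G := filter_from F (fun O => [set O' | F O' /\ O `<=` O']).
have FG : Filter G.
  apply: filter_from_filter; first by exists set0.
  move=> O O' FO FO'; exists (O `|` O'); first exact: FU.
  by move=> V [FV]; rewrite subUset => -[? ?].
have [|O FO AO] := cA _ G (fun O x => F O /\ O x) FG.
  move=> x Ax.
  have [O FO Ox] := AF x Ax.
  exists (O, [set O' | F O' /\ O `<=` O']) => /=.
    by split; [apply: open_nbhs_nbhs; split => //; exact: Fo | exists O].
  by move=> [y V] /= [Oy [FV OV]]; split => //; exact: OV.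
by exists O => // x Ax; have [] := AO O (conj FO (@subset_refl _ O)) x Ax.
Qed.

Lemma compact_cover_seq A F : compact A ->
    (forall O, F O -> open O) -> (forall x, A x -> exists2 O, F O & O x) ->
  exists2 s : seq (set T), (forall O, O \in s -> F O) &
    A `<=` \bigcup_(O in [set` s]) O.
Proof.
move=> cA Fo AF.
pose F' := [set \bigcup_(O in [set` s]) O | s in
  [set s : seq (set T) | forall O, O \in s -> F O]].
have [| | | |_ [s sF <-] As] := @compact_directed_cover A F' cA;
  last by exists s.
- by move=> _ [s sF <-]; apply: bigcup_open => O /= /sF/Fo.
- by exists [::] => //; rewrite -subset0 => x [].
- move=> _ _ [s sF <-] [t tF <-]; exists (s ++ t).
    by move=> O; rewrite mem_cat => /orP[/sF|/tF].
  rewrite -bigcup_setU; congr bigcup.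
  by apply/seteqP; split => O /=; rewrite mem_cat => /orP.
- move=> x /AF[O FO Ox]; exists O => //; exists [:: O].
    by move=> V; rewrite inE => /eqP ->.
  apply/seteqP; split => [y [V /=]|y Oy]; first by rewrite inE => /eqP ->.
  by exists O; rewrite //= inE.
Qed.

Lemma compact_setT_sub A : compact A -> compact [set: A].
Proof.
move=> cA; apply/compact_near_coveringP => I F P FF cov.
move/compact_near_coveringP : cA =>
  /(_ I F (fun i x => forall a : A, set_val a = x -> P i a) FF) AP.
suff : F [set i | A `<=` [set x | forall a : A, set_val a = x -> P i a]].
  by apply: filterS => i iP a _; exact: (iP (set_val a) (set_valP a)).
apply: AP => x Ax.
have [[U V] [/= [W [[W' oW' WW'] Wx WU] FV]] UVP] :=
  cov (SigSub (mem_set Ax)) Logic.I.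
exists (W', V); first split => //=.
  by apply: open_nbhs_nbhs; split => //; move: Wx; rewrite -WW'.
move=> [y i] /= [W'y Vi] a ay; apply: (UVP (a, i)); split => //=.
by apply: WU; rewrite -WW' /= ay.
Qed.

Lemma hausdorff_sub A : hausdorff_space T -> hausdorff_space A.
Proof.
move=> hT p q pq; apply: val_inj; apply: hT => U V Up Vq.
have [] := pq (set_val @^-1` U) (set_val @^-1` V).
- exact: initial_continuous.
- exact: initial_continuous.
by move=> z [Uz Vz]; exists (set_val z).
Qed.

Lemma accessible_regular_hausdorff :
  accessible_space T -> regular_space T -> hausdorff_space T.
Proof.
move=> T1 Treg; rewrite open_hausdorff => x y.
move=> /T1[A [oA /set_mem Ax /set_mem Ay]].
have [U Ux UA] : filter_from (nbhs x) closure A.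
  by apply: Treg; apply: open_nbhs_nbhs.
exists (U°, ~` closure U); split => /=.
- by rewrite inE.
- by rewrite inE => /UA.
- exact: open_interior.
- by apply: closed_openC; exact: closed_closure.
- apply/eqP/disjoints_subset; rewrite setCK => z.
  by move=> /interior_subset/subset_closure.
Qed.

(** A point off a compact set of a Hausdorff space has a neighbourhood whose
    closure avoids that set. *)
Lemma compact_closure_avoid K x : hausdorff_space T -> compact K -> ~ K x ->
  exists2 V, open_nbhs x V & K `&` closure V = set0.
Proof.
move=> hT cK Kx.
pose F := [set O | open O /\ exists2 V, open_nbhs x V & V `&` O = set0].
have [| | | |O [oO [V Vx VO]] KO] := @compact_directed_cover K F cK.
- by move=> O [].
- split; first exact: open0.
  by exists setT; [split => //; exact: openT | rewrite setI0].
- move=> O O' [oO [V [oV Vx] VO]] [oO' [V' [oV' V'x] VO']].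
  split; first exact: openU.
  exists (V `&` V'); first by split => //; exact: openI.
  rewrite setIUr setIAC VO set0I set0U; by rewrite -setIA VO' setI0.
- move=> y Ky; have xy : x != y by apply: contra_notN Kx => /eqP ->.
  move: hT; rewrite open_hausdorff => /(_ x y xy)[[/= V O]].
  move=> [/set_mem Vx /set_mem Oy]; case=> oV oO /eqP VO.
  by exists O => //; split => //; exists V.
exists V => //; rewrite -subset0 => y [/KO Oy cVy].
by have [] := cVy O (open_nbhs_nbhs (conj oO Oy)); rewrite VO.
Qed.

End Compactness.

(** * D0 spaces *)

(** Topological embeddings, up to injectivity: [S] carries the topology induced
    by [f]. *)
Definition embedded (S T : topologicalType) (f : S -> T) :=
  continuous f /\ forall U : set S, open U -> exists2 W, open W & f @^-1` W = U.

Lemma D0_embedded (S T : topologicalType) (f : S -> T) :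
  embedded f -> D0_space T -> D0_space S.
Proof.
move=> [cf ef] D0T A cA.
have [|B [cB BA Bb]] := D0T (f @` A).
  by apply: continuous_compact => //; exact: continuous_subspaceT.
exists (preimage f @` B); split.
- exact: sub_countable (card_image_le _ _) cB.
- move=> _ [V BV <-]; have [oV AV] := BA V BV; split.
    by move: V oV {BV AV}; apply/continuousP.
  by move=> x Ax; apply: AV; exists x.
- move=> U oU AU; have [W oW WU] := ef U oU.
  have [|V BV VW] := Bb W oW.
    by move=> _ [x Ax <-]; move: (AU x Ax); rewrite -WU.
  by exists (f @^-1` V); [exists V | rewrite -WU => x /VW].
Qed.

Lemma D0_subset (T : topologicalType) (A B : set T) :
  A `<=` B -> D0_space B -> D0_space A.
Proof.
move=> AB.
pose f (a : A) : B := SigSub (mem_set (AB _ (set_valP a))).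
apply: (@D0_embedded A B f); split.
  apply/continuousP => _ [W oW <-]; exists W => //.
move=> _ [W oW <-]; exists (set_val @^-1` W) => //; by exists W.
Qed.

Lemma D0_compact_covering_image (R : realType) (Y : topologicalType) :
  open_compact_covering_metric_image R Y -> D0_space Y.
Proof.
move=> [M [f [cf of' ccf _]]] A /ccf[K cK KA].
pose N n : set M := \bigcup_(x in K) (ball x (n.+1%:R^-1 : R)%R)°.
exists (range (fun n => f @` N n)); split.
- exact: card_image_le.
- move=> _ [n _ <-]; split.
    by apply: of'; apply: bigcup_open => x _; exact: open_interior.
  rewrite -KA => _ [x Kx <-]; exists x => //; exists x => //.
  by apply: nbhsx_ballx; rewrite invr_gt0 ltr0Sn.
- move=> U oU AU.
  have [n nU] : exists n, N n `<=` f @^-1` U.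
    have oU' : open (f @^-1` U) by move: U oU {AU}; apply/continuousP.
    move/compact_near_coveringP : cK => /(_ nat \oo
      (fun n x => ball x (n.+1%:R^-1 : R)%R `<=` f @^-1` U) _).
    case=> [x Kx|n _ /(_ n (leqnn n)) nU]; last first.
      by exists n => y [x /nU xU /interior_subset/xU].
    have : nbhs x (f @^-1` U).
      by apply: open_nbhs_nbhs; split => //; apply: AU; rewrite -KA; exists x.
    rewrite -nbhs_ballE => -[e /= e0 eU].
    have e20 : (0 < e / 2)%R by rewrite divr_gt0.
    near=> y n => /= z yz; apply: eU; apply: (@ball_split _ _ y).
      near: y; apply: near_ball; by [].
    apply: le_ball yz; apply: ltW.
    by near: n; exact: near_infty_natSinv_lt (PosNum e20).
  exists (f @` N n); first by exists n.
  by move=> _ [x /nU + <-].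
Unshelve. all: by end_near. Qed.

(** * The Vietoris topology and the space of pairs *)

Lemma diag_continuous (T : topologicalType) : continuous (fun x : T => (x, x)).
Proof. by move=> x; apply: cvg_pair; exact: cvg_id. Qed.

Section VietorisTheory.
Variable X : topologicalType.
Notation CL := (closed_hyperspace X).
Implicit Types (Us : seq (set X)) (H : CL).

Lemma vietoris_open Us : open_seq Us -> open (vietoris_base Us).
Proof.
by move=> oU; exists [set Us]; [move=> _ -> | rewrite bigcup_set1].
Qed.

Lemma vietoris_open_nbhs (W : set CL) H : open W -> W H ->
  exists Us, [/\ open_seq Us, vietoris_base Us H & vietoris_base Us `<=` W].
Proof.
move=> [D Do <-] [Us DUs UsH]; exists Us; split => //; first exact: Do.
by move=> K UsK; exists Us.
Qed.

Lemma near_mem_seq Us (x : X) : open_seq Us ->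
  \forall z \near x, forall U, U \in Us -> U x -> U z.
Proof.
elim: Us => [|V Us IH] oU; first by near=> z => U; rewrite in_nil.
have oUs : open_seq Us by move=> U UUs; apply: oU; rewrite inE UUs orbT.
have Vz : \forall z \near x, V x -> V z.
  have [Vx|nVx] := pselect (V x); last by near=> z.
  have : nbhs x V.
    by apply: open_nbhs_nbhs; split => //; apply: oU; rewrite inE eqxx.
  by apply: filterS.
near=> z => U; rewrite inE => /predU1P[->|UUs]; first by near: z.
by move: U UUs; near: z; exact: IH.
Unshelve. all: by end_near. Qed.

Section Pairs.
Hypothesis T1 : accessible_space X.

Lemma closed_pair (x y : X) : closed [set x; y].
Proof. by apply: (accessible_finite_set_closed.1 T1). Qed.

Lemma pair_nonempty (x y : X) : [set x; y] !=set0.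
Proof. by exists x; left. Qed.

Lemma card_pair_le2 (x y : X) : ([set x; y] #<= `I_2)%card.
Proof.
have -> : [set x; y] = (fun n => if n == 0%N then x else y) @` `I_2.
  apply/seteqP; split => [z [->|->]|_ [[|[|//]] _ <-]] /=.
  - by exists 0%N.
  - by exists 1%N.
  - by left.
  - by right.
exact: card_image_le.
Qed.

(** The set [{x, y}], as an element of the space of closed sets, then as an
    element of its subspace of sets with at most two elements. *)
Definition closed_hyperpair (x y : X) : CL :=
  ClosedHyperspace (@closed_pair x y) (pair_nonempty x y).

Lemma closed_hyperpair_le2 (x y : X) : hyperspace2 X (closed_hyperpair x y).
Proof. exact: card_pair_le2. Qed.

Definition hyperpair (xy : X * X) : hyperspace2 X :=
  SigSub (mem_set (closed_hyperpair_le2 xy.1 xy.2)).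

Lemma hyperpair_continuous : continuous hyperpair.
Proof.
apply/continuousP => _ [W oW <-]; rewrite openE => -[x y] /= Wxy.
have [Us [oU [UH HU] UW]] := vietoris_open_nbhs oW Wxy.
exists ([set z | forall U, U \in Us -> U x -> U z],
  [set z | forall U, U \in Us -> U y -> U z]).
  by split; exact: near_mem_seq.
move=> [x' y'] /= [xx' yy']; apply: UW; split => /=.
  move=> z [->|->].
    have [|U UUs Ux] := UH x; first by left.
    by exists U => //; exact: xx'.
  have [|U UUs Uy] := UH y; first by right.
  by exists U => //; exact: yy'.
move=> U UUs; have [z [[->|->] Uz]] := HU U UUs.
  by exists x'; split; [left | exact: xx'].
by exists y'; split; [right | exact: yy'].
Qed.

Lemma hyperpair_diag_embedded : embedded (fun x => hyperpair (x, x)).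
Proof.
split.
  move=> x; apply: (@continuous_comp X (X * X)%type _ (fun x => (x, x))).
    exact: diag_continuous.
  exact: hyperpair_continuous.
move=> U oU; exists (set_val @^-1` vietoris_base [:: U]).
  exists (vietoris_base [:: U]) => //; apply: vietoris_open => V.
  by rewrite inE => /eqP ->.
apply/seteqP; split => x /=.
  by case=> /(_ x (or_introl erefl))[V /=]; rewrite inE => /eqP ->.
move=> Ux; split => [y [->|->]|V]; [exists U | exists U|] => //=; rewrite inE //.
by move=> /eqP ->; exists x; split => //; left.
Qed.

End Pairs.
End VietorisTheory.

(** * Metrizability of uniform spaces with a countable base *)

Lemma entourage_nbhs_diag (T : uniformType) (E : set (T * T)) (x : T) :
  entourage E -> nbhs (x, x) E.
Proof.
move=> entE.
exists (xsection ((split_ent E)^-1)%relation x, xsection (split_ent E) x).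
  by split; apply: nbhs_entourage => //; exact: entourage_inv.
move=> [y z] /= [/xsectionP yx /xsectionP xz]; exact: (entourage_split x).
Qed.

(** Lebesgue number lemma: on a compact uniform space the neighbourhoods of the
    diagonal are entourages. *)
Lemma compact_nbhs_diag_entourage (T : uniformType) (W : set (T * T)) :
  compact [set: T] -> (forall x : T, nbhs (x, x) W) -> entourage W.
Proof.
move=> cT nW.
pose F := [set O : set T | open O /\ exists2 E, entourage E &
  forall x y, O x -> E (x, y) -> W (x, y)].
have [| | | |O [_ [E entE EW]] OT] := @compact_directed_cover T _ F cT.
- by move=> O [].
- by split; [exact: open0 | exists setT => //; exact: entourageT].
- move=> O O' [oO [E entE EW]] [oO' [E' entE' EW']]; split; first exact: openU.
  exists (E `&` E'); first exact: filterI.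
  by move=> x y [Ox|O'x] [Exy E'xy]; [exact: EW | exact: EW'].
- move=> x _; have [[U V] /= [Ux Vx] UVW] := nW x.
  have : nbhs x (U `&` V) by exact: filterI.
  rewrite -nbhs_entourageE => -[E entE EUV].
  exists ((xsection (split_ent E) x)°).
    split; first exact: open_interior.
    exists (split_ent E) => // y z /interior_subset/xsectionP xy yz.
    apply: UVW; split => /=.
      by have [] := EUV y (mem_set (split_ent_subset entE xy)).
    by have [] := EUV z (mem_set (entourage_split y entE xy yz)).
  by have [] := open_nbhs_entourage x (entourage_split_ent entE).
by apply: filterS entE => -[x y] Exy; apply: EW => //; exact: OT.
Qed.

(** The balls of a pseudometric structure need not be the balls of a distance;
    the infimum of the radii [e] such that [ball x e y] is a distance with
    the same topology. *)
Section InfMetric.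
Context {R : realType} {T : pseudoMetricType R}.
Hypothesis T_bounded : forall x y : T, exists e : R, ball x e y.
Hypothesis T_hausdorff : hausdorff_space T.
Local Open Scope ring_scope.

Definition inf_dist (x y : T) : R := inf [set e | 0 < e /\ ball x e y].

Lemma has_inf_dist (x y : T) : has_inf [set e : R | 0 < e /\ ball x e y].
Proof.
split; last by exists 0 => e [/ltW].
have [e xey] := T_bounded x y; exists (Num.max e 1); split => /=.
  by rewrite lt_max ltr01 orbT.
by apply: le_ball xey; rewrite le_max lexx.
Qed.

Lemma inf_dist_ltP (x y : T) (e : R) : inf_dist x y < e -> ball x e y.
Proof.
move=> /(inf_lt (has_inf_dist x y).1)[d [d0 xdy] /ltW de].
exact: le_ball xdy.
Qed.

Lemma inf_dist_le (x y : T) (e : R) : 0 < e -> ball x e y -> inf_dist x y <= e.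
Proof. by move=> e0 xey; apply: ge_inf => //; have [] := has_inf_dist x y. Qed.

Lemma inf_dist_ge0 x y : 0 <= inf_dist x y.
Proof.
by apply: lb_le_inf; [have [] := has_inf_dist x y | move=> e [/ltW]].
Qed.

Lemma inf_distxx x : inf_dist x x = 0.
Proof.
apply/eqP; rewrite eq_le inf_dist_ge0 andbT; apply/ler_addgt0Pl => e e0.
by rewrite addr0; apply: inf_dist_le => //; exact: ballxx.
Qed.

Lemma inf_dist_eq0 x y : inf_dist x y = 0 -> x = y.
Proof.
move=> xy0; apply: (close_eq T_hausdorff); rewrite ball_close => e.
by apply: inf_dist_ltP; rewrite xy0.
Qed.

Lemma inf_dist_sym x y : inf_dist x y = inf_dist y x.
Proof.
by congr inf; apply/seteqP; split => e [e0 xey]; split => //; exact: ball_sym.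
Qed.

Lemma inf_dist_triangle y x z : inf_dist x z <= inf_dist x y + inf_dist y z.
Proof.
apply/ler_addgt0Pr => e e0.
have e20 : 0 < e / 2 by rewrite divr_gt0.
have -> : inf_dist x y + inf_dist y z + e =
    (inf_dist x y + e / 2) + (inf_dist y z + e / 2).
  by rewrite addrACA -splitr.
apply: inf_dist_le; first by rewrite addr_gt0// ltr_wpDl// inf_dist_ge0.
by apply: (@ball_triangle _ _ y); apply: inf_dist_ltP; rewrite ltrDl.
Qed.

(** A copy of [T] metrized by [inf_dist]; it depends on the two hypotheses so
    that its metric instance can be declared. *)
Definition inf_metric : Type := let _ := T_bounded in let _ := T_hausdorff in T.

HB.instance Definition _ := Choice.on inf_metric.
HB.instance Definition _ := isMetric.Build R inf_metric
  inf_distxx inf_dist_eq0 inf_dist_sym inf_dist_triangle.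

Lemma bounded_hausdorff_metrizable : metrizable R T.
Proof.
exists inf_metric, (id : T -> inf_metric), (id : inf_metric -> T); split => //.
  move=> x U; rewrite -nbhs_ballE => -[e /= e0 eU].
  apply/nbhs_ballP; exists (e / 2); first by rewrite /= divr_gt0.
  move=> y xy; apply: eU; rewrite ballEmdist /=.
  apply: (@le_lt_trans _ _ (e / 2)); last by rewrite gtr_pMr// invf_lt1// ltr1n.
  by apply: inf_dist_le; rewrite ?divr_gt0.
move=> x U; rewrite -nbhs_ballE => -[e /= e0 eU].
apply/nbhs_ballP; exists e => // y xy; apply: eU.
by move: xy; rewrite ballEmdist => /inf_dist_ltP.
Qed.

End InfMetric.

Lemma countable_uniformity_metrizable (R : realType) (T : uniformType) :
  countable_uniformity T -> hausdorff_space T -> metrizable R T.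
Proof.
move=> cT hT.
pose P : pseudoMetricType R := countable_uniform.type cT.
apply: (@bounded_hausdorff_metrizable R P) => // x y.
by exists 2%R; exact: countable_uniform.countable_uniform_bounded.
Qed.

(** * Metrizability of compact sets when the space of pairs is D0 *)

Lemma D0_hyperspace2_metrizable (R : realType) (X : topologicalType) :
  regular_space X -> accessible_space X -> D0_space (hyperspace2 X) ->
  forall A : set X, compact A -> metrizable R A.
Proof.
move=> Xreg T1 D0 A cA.
have hX := accessible_regular_hausdorff T1 Xreg.
have hA : hausdorff_space A by exact: hausdorff_sub.
have cTA := compact_setT_sub cA.
have crA : completely_regular_space A.
  apply: (@normal_completely_regular R); first exact: compact_normal.
  exact: hausdorff_accessible.
(* [T] is [A], with a uniformity inducing its topology *)
pose T : uniformType := @completely_regular_uniformity.type R _ crA.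
have TA : metrizable R T; last by [].
apply: countable_uniformity_metrizable; last exact: hA.
pose p (xy : A * A) := hyperpair T1 (set_val xy.1, set_val xy.2).
have pc : continuous p.
  move=> xy; apply: (@continuous_comp _ (X * X)%type _
      (fun xy : A * A => (set_val xy.1, set_val xy.2))); last first.
    exact: hyperpair_continuous.
  apply: cvg_pair => /=; apply: (@continuous_comp (A * A)%type A X).
  - exact: cvg_fst.
  - exact: initial_continuous.
  - exact: cvg_snd.
  - exact: initial_continuous.
have [|B [cB BD Bb]] := D0 (range (fun a : A => p (a, a))).
  apply: continuous_compact => //; apply: continuous_subspaceT => x.
  apply: (@continuous_comp A (A * A)%type _ (fun x => (x, x))); last exact: pc.
  exact: diag_continuous.
exists (preimage p @` B); split.
- exact: sub_countable (card_image_le _ _) cB.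
- move=> _ [V BV <-]; have [oV DV] := BD V BV.
  apply: (@compact_nbhs_diag_entourage T) => // x.
  apply: (pc (x, x)); apply: open_nbhs_nbhs; split => //.
  by apply: DV; exists x.
- move=> E entE.
  (* the sets included in some open [O] that is [E]-small on [A] form an open
     set of pairs, which contains the singletons of points of [A] *)
  pose F := [set O : set X | open O /\
    forall x y : A, O (set_val x) -> O (set_val y) -> E (x, y)].
  pose G := \bigcup_(O in F) vietoris_base [:: O].
  have [| |V BV VG] := Bb (set_val @^-1` G).
  + exists G => //; apply: bigcup_open => O [oO _]; apply: vietoris_open => V.
    by rewrite inE => /eqP ->.
  + move=> _ [a _ <-].
    have [[U V] /= [[_ [[U' oU' <-] Ua UU]] [_ [[V' oV' <-] Va VV]]] UV] :=
      @entourage_nbhs_diag T E a entE.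
    exists (U' `&` V').
      split; first exact: openI.
      by move=> x y [U'x _] [_ V'y]; apply: UV; split; [exact: UU | exact: VV].
    split => /=.
      by move=> y [->|->]; exists (U' `&` V'); rewrite //= inE.
    by move=> W; rewrite inE => /eqP ->; exists (set_val a); split => //; left.
  exists (p @^-1` V); first by exists V.
  move=> [x y] /= /VG[O [_ OE] [/= xyO _]].
  apply: OE.
    by have [|O' /=] := xyO (set_val x); [left | rewrite inE => /eqP ->].
  by have [|O' /=] := xyO (set_val y); [right | rewrite inE => /eqP ->].
Qed.

(** * Outer bases of compact sets *)

(** [b] enumerates open sets of [T] among which there is a neighbourhood base at
    every point of [A]; this is stronger than having a countable base in the
    subspace [A], because the sets are small in [T]. *)
Definition outer_base (T : topologicalType) (A : set T) (b : nat -> set T) :=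
  (forall n, open (b n)) /\
  forall x U, A x -> open U -> U x -> exists2 n, b n x & b n `<=` U.

(** Repeating or adding the empty set does no harm to an outer base, so a
    countable, possibly empty, family of open sets can be indexed by [nat]. *)
Lemma countable_open_enum (T : topologicalType) (F : set (set T)) :
    countable F -> (forall O, F O -> open O) ->
  exists2 b : nat -> set T, forall n, open (b n) &
    forall O, F O -> exists n, b n = O.
Proof.
move=> /pfcard_geP[->|/unsquash f] Fo.
  by exists (fun=> set0) => // n; exact: open0.
exists f; first by move=> n; apply: Fo; exact: funS.
by move=> O /(@surj _ _ _ _ f)[n _ fn]; exists n.
Qed.

(** The sets [G n] need not be open: they form a network at the points of [A].
    They are the members of a countable base of [A], seen in [X]. *)
Lemma metrizable_compact_network (R : realType) (X : topologicalType)
    (A : set X) :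
    compact A -> metrizable R A ->
  exists G : nat -> set X,
    forall x U, A x -> nbhs x U -> exists2 n, G n x & G n `<=` U.
Proof.
move=> cA [M [f [g [cf cg fK gK]]]].
have [[x Ax]|A0] := pselect (A !=set0); last first.
  by exists (fun=> set0) => x U Ax; case: A0; exists x.
pose P := HB.pack_for (pseudoPMetricType R) M
  (isPointed.Build M (f (SigSub (mem_set Ax)))).
have cP : compact [set: P].
  have -> : [set: P] = f @` setT.
    by apply/seteqP; split => // y _; exists (g y) => //; exact: gK.
  apply: (@continuous_compact A M); first exact: continuous_subspaceT.
  exact: compact_setT_sub.
have [B cB [Bo Bb]] := compact_second_countable cP.
have [b _ bB] := countable_open_enum cB Bo.
exists (fun n => set_val @` (f @^-1` b n)) => y U Ay Uy.
pose a : A := SigSub (mem_set Ay).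
have : nbhs (f a) (g @^-1` (set_val @^-1` U)).
  apply: cg; rewrite fK; exact: initial_continuous.
move=> /Bb[V [/bB[n <-] na] nU]; exists n; first by exists a.
by move=> _ [z nz <-]; have := nU _ nz; rewrite /= fK.
Qed.

Lemma D0_compact_outer_base (R : realType) (X : topologicalType) (A : set X) :
    regular_space X -> D0_space X -> compact A -> metrizable R A ->
  exists b, outer_base A b.
Proof.
move=> Xreg D0 cA /(metrizable_compact_network cA)[G GA].
have /choice[B Bp] n := D0 _ (compact_closedI cA (@closed_closure _ (G n))).
have [| |b bo bB] := @countable_open_enum X (\bigcup_n B n).
- by apply: bigcup_countable => // n _; have [] := Bp n.
- by move=> O [n _ BO]; have [_ /(_ O BO)[]] := Bp n.
exists b; split => // x U Ax oU Ux.
have [V Vx VU] : filter_from (nbhs x) closure U.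
  by apply: Xreg; apply: open_nbhs_nbhs.
have [n nx nV] := GA x V Ax Vx.
have [_ BA Bb] := Bp n.
have [|O BO OU] := Bb U oU; first by move=> y [_ /(closureS nV)/VU].
have [|m mO] := bB O; first by exists n.
exists m; rewrite mO //; apply: (BA O BO).2; split => //.
exact: subset_closure.
Qed.

Section CompactHyperspace.
Variable X : topologicalType.
Notation CL := (closed_hyperspace X).
Notation KX := (compact_hyperspace X).

Lemma compact_bigcup_hyperspace (F : set KX) :
  compact F -> compact (\bigcup_(H in F) hyperset (set_val H)).
Proof.
move=> /compact_near_coveringP cF; apply/compact_near_coveringP => I G P FG cov.
suff : G [set i | F `<=` [set H | hyperset (set_val H) `<=` P i]].
  by apply: filterS => i iP x [H FH Hx]; exact: (iP H FH).
apply: cF => H FH.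
pose N := [set O : set X | open O /\ exists2 V, G V &
  forall x i, O x -> V i -> P i x].
have [| | | |O [oO [V GV OV]] HO] :=
  @compact_directed_cover X (hyperset (set_val H)) N (set_valP H).
- by move=> O [].
- by split; [exact: open0 | exists setT => //; exact: filterT].
- move=> O O' [oO [V GV OV]] [oO' [V' GV' OV']]; split; first exact: openU.
  exists (V `&` V'); first exact: filterI.
  by move=> x i [Ox|O'x] [Vi V'i]; [exact: OV | exact: OV'].
- move=> x Hx; have [|[U V] /= [Ux GV] UV] := cov x; first by exists H.
  exists U°; last by [].
  split; first exact: open_interior.
  by exists V => // y i /interior_subset Uy Vi; exact: (UV (y, i)).
exists (set_val @^-1` vietoris_base [:: O], V); first split => //=.
  apply: initial_continuous; apply: open_nbhs_nbhs; split.
    by apply: vietoris_open => W; rewrite inE => /eqP ->.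
  split; first by move=> x Hx; exists O; rewrite /= ?inE //; exact: HO.
  move=> W; rewrite inE => /eqP ->.
  have [x Hx] := hyperset_nonempty (set_val H).
  by exists x; split => //; exact: HO.
move=> [K i] /= [[KO _] Vi] x Kx; apply: OV => //.
by have [W /=] := KO x Kx; rewrite inE => /eqP ->.
Qed.

(** A basic Vietoris neighbourhood of a compact set [H] contained in [A] can be
    refined to one that uses finitely many members of an outer base of [A]. *)
Lemma vietoris_outer_base_refine (A : set X) (b : nat -> set X) (H : CL)
    (Us : seq (set X)) :
    outer_base A b -> hyperset H `<=` A -> compact H -> open_seq Us ->
    vietoris_base Us H ->
  exists s : seq nat, vietoris_base (map b s) H /\
    vietoris_base (map b s) `<=` vietoris_base Us.
Proof.
move=> [bo bA] HA cH oU [HU UH].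
pose F := [set b n | n in [set n | b n `&` H !=set0 /\
  exists2 U, U \in Us & b n `<=` U]].
have [| |s sF Hs] := @compact_cover_seq X (hyperset H) F cH.
- by move=> _ [n _ <-]; exact: bo.
- move=> x Hx; have [U /= UU Ux] := HU x Hx.
  have [n nx nU] := bA x U (HA x Hx) (oU U UU) Ux.
  by exists (b n) => //; exists n => //; split; [exists x | exists U].
have /choice[c cP] U : exists n, U \in Us -> b n `&` H !=set0 /\ b n `<=` U.
  have [UU|] := boolP (U \in Us); last by exists 0%N.
  have [x [Hx Ux]] := UH U UU; have [n nx nU] := bA x U (HA x Hx) (oU U UU) Ux.
  by exists n => _; split => //; exists x.
have /choice[d dP] O : exists n, O \in s -> [/\ b n = O, b n `&` H !=set0 &
    exists2 U, U \in Us & b n `<=` U].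
  have [/sF[n [nH nU] nO]|] := boolP (O \in s); last by exists 0%N.
  by exists n.
(* the members listed in [s] cover [H] and refine the open sets of [Us]; those
   coming from [c] ensure that each of these open sets is met *)
exists (map d s ++ map c Us); split; [split|].
- move=> x /Hs[O /= Os Ox]; have [dO _ _] := dP O Os.
  by exists O => //=; rewrite map_cat mem_cat -[X in X \in _]dO !map_f.
- move=> W /mapP[n + ->]; rewrite setIC mem_cat => /orP[] /mapP[V Vs ->].
    by have [] := dP V Vs.
  by have [] := cP V Vs.
- move=> K [KU UK]; split.
    move=> x /KU[W /= /mapP[n + ->]].
    rewrite mem_cat => /orP[] /mapP[V Vs ->] Wx.
      by have [_ _ [U UU dU]] := dP V Vs; exists U => //; exact: dU.
    by have [_ cV] := cP V Vs; exists V => //; exact: cV.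
  move=> U UU; have [|x [Kx bx]] := UK (b (c U)).
    by rewrite map_f // mem_cat orbC map_f.
  by exists x; split => //; apply: (cP U UU).2.
Qed.

(** The outer base consists of the basic Vietoris sets built on finite sequences
    of members of an outer base of the union. *)
Lemma compact_hyperspace_outer_base :
    (forall A : set X, compact A -> exists b, outer_base A b) ->
  forall F : set KX, compact F -> exists b, outer_base F b.
Proof.
move=> oX F cF; have [b ob] := oX _ (compact_bigcup_hyperspace cF).
pose c n : set KX :=
  set_val @^-1` vietoris_base (map b (odflt [::] (unpickle n))).
exists c; split.
  move=> n; exists (vietoris_base (map b (odflt [::] (unpickle n)))) => //.
  by apply: vietoris_open => _ /mapP[m _ ->]; exact: ob.1.
move=> H _ FH [W oW <-] WH.
have [Us [oU UH UW]] := vietoris_open_nbhs oW WH.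
have HF : hyperset (set_val H) `<=` \bigcup_(K in F) hyperset (set_val K).
  by move=> x Hx; exists H.
have [s [sH sU]] := vietoris_outer_base_refine ob HF (set_valP H) oU UH.
exists (pickle s); rewrite /c pickleK //.
by move=> K /sU/UW.
Qed.

End CompactHyperspace.

Lemma hyperspace_hausdorff (X : topologicalType) :
  regular_space X -> hausdorff_space (closed_hyperspace X).
Proof.
move=> Xreg H K clHK.
(* a point [x] of [H1] off [H2] has, by regularity, a neighbourhood [U] such
   that no set meets the interior of [U] and is included in [~` closure U] *)
have sub (H1 H2 : closed_hyperspace X) : cluster (nbhs H1) H2 ->
    hyperset H1 `<=` hyperset H2.
  move=> cl x H1x; apply: contrapT => H2x.
  have [U Ux UH] : filter_from (nbhs x) closure (~` hyperset H2).
    apply: Xreg; apply: open_nbhs_nbhs; split => //.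
    by apply: closed_openC; exact: hyperset_closed.
  have [||L [[_ /(_ U°)LU] [LH _]]] :=
    cl (vietoris_base [:: setT; U°]) (vietoris_base [:: ~` closure U]).
  - apply: open_nbhs_nbhs; split.
      apply: vietoris_open => V; rewrite !inE => /orP[] /eqP ->.
        exact: openT.
      exact: open_interior.
    split; first by move=> y _; exists setT; rewrite //= inE eqxx.
    move=> V; rewrite !inE => /orP[] /eqP ->; first by exists x.
    by exists x.
  - apply: open_nbhs_nbhs; split.
      apply: vietoris_open => V; rewrite inE => /eqP ->.
      by apply: closed_openC; exact: closed_closure.
    have H2U : hyperset H2 `<=` ~` closure U by move=> y H2y /UH.
    split.
      by move=> y H2y; exists (~` closure U); rewrite /= ?inE //; exact: H2U.
    move=> V; rewrite inE => /eqP ->; have [y H2y] := hyperset_nonempty H2.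
    by exists y; split => //; exact: H2U.
  have [|y [Ly Uy]] := LU; first by rewrite !inE eqxx orbT.
  have [V /=] := LH y Ly; rewrite inE => /eqP -> []; apply: subset_closure.
  exact: interior_subset.
have HK : hyperset H = hyperset K.
  apply/seteqP; split; first exact: sub.
  by apply: sub => A B KA HB; rewrite setIC; exact: clHK.
case: H K HK {clHK} => [H cH nH] [K cK nK] /= HK; subst K.
by congr ClosedHyperspace; exact: Prop_irrelevance.
Qed.

(** * Spaces whose compact sets have outer bases *)

(** Sequences of open sets that form a neighbourhood base at a point.  The point
    is a field, so that the map to [Y] is a projection; in a Hausdorff space it
    is determined by the sequence ([pointed_base_eq]). *)
Record pointed_base (Y : topologicalType) := PointedBase {
  pbase :> nat -> set Y;
  ppoint : Y;
  pbase_open : forall n, open (pbase n);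
  pbase_point : forall n, pbase n ppoint;
  pbase_nbhs : forall U, open U -> U ppoint -> exists n, pbase n `<=` U
}.

HB.instance Definition _ (Y : topologicalType) := gen_eqMixin (pointed_base Y).
HB.instance Definition _ (Y : topologicalType) :=
  gen_choiceMixin (pointed_base Y).

Section PointedBase.
Variable Y : topologicalType.
Notation M := (pointed_base Y).

(** Pairs of sequences with the same first [n] terms; they generate the
    uniformity of the space of sequences. *)
Definition agree n : set (M * M) :=
  [set ab : M * M | forall i, (i < n)%N -> ab.1 i = ab.2 i].

Definition agree_entourage : set_system (M * M) := filter_from setT agree.

Lemma agree_entourage_filter : Filter agree_entourage.
Proof.
apply: filter_from_filter; first by exists 0%N.
move=> m n _ _; exists (maxn m n) => // -[a b] ab.
by split => i ilt; apply: ab; rewrite leq_max ilt ?orbT.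
Qed.

Lemma agree_entourage_diagonal E : agree_entourage E -> diagonal `<=` E.
Proof. by move=> [n _ nE] [a b] /diagonalP ->; exact: nE. Qed.

Lemma agree_entourage_inv E :
  agree_entourage E -> agree_entourage (E^-1)%relation.
Proof.
by move=> [n _ nE]; exists n => // -[a b] ab; apply: nE => i /ab.
Qed.

Lemma agree_entourage_split E : agree_entourage E ->
  exists2 D, agree_entourage D & (D \; D)%relation `<=` E.
Proof.
move=> [n _ nE]; exists (agree n); first by exists n.
move=> [a c] [b] /= ab bc; apply: nE => i ilt.
by rewrite /= (ab i ilt) (bc i ilt).
Qed.

HB.instance Definition _ := isUniform.Build M agree_entourage_filter
  agree_entourage_diagonal agree_entourage_inv agree_entourage_split.

Lemma nbhs_pointed_base (a : M) (U : set M) :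
  nbhs a U <-> exists n, [set b : M | agree n (a, b)] `<=` U.
Proof.
rewrite -nbhs_entourageE; split.
  move=> [E [n _ nE] EU]; exists n => b ab; apply: EU; apply/mem_set; exact: nE.
move=> [n nU]; exists (agree n); first by exists n.
by move=> b /set_mem; exact: nU.
Qed.

Lemma pointed_base_countable_uniformity : countable_uniformity M.
Proof.
exists (range agree); split; first exact: card_image_le.
  by move=> _ [n _ <-]; exists n.
by move=> E [n _ nE]; exists (agree n); first by exists n.
Qed.

Lemma pointed_base_eq (a b : M) :
  hausdorff_space Y -> (forall n, a n = b n) -> a = b.
Proof.
move=> hY ab.
have eqp : ppoint a = ppoint b.
  apply: hY => U V; rewrite nbhsE => -[U' [oU' U'a] UU] bV.
  have [n nU] := pbase_nbhs oU' U'a.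
  exists (ppoint b); split; last exact: nbhs_singleton.
  by apply: UU; apply: nU; rewrite ab; exact: pbase_point.
case: a b ab eqp => [A x oA Ax Ab] [B y oB By Bb] /= /funext AB xy.
by subst B y; congr PointedBase; exact: Prop_irrelevance.
Qed.

Lemma pointed_base_hausdorff : hausdorff_space Y -> hausdorff_space M.
Proof.
move=> hY a b ab; apply: pointed_base_eq => // n.
have [||c [/= ac bc]] :=
  ab [set c : M | agree n.+1 (a, c)] [set c : M | agree n.+1 (b, c)].
- by apply/nbhs_pointed_base; exists n.+1.
- by apply/nbhs_pointed_base; exists n.+1.
by rewrite (ac n) // (bc n).
Qed.

Lemma ppoint_continuous : continuous (@ppoint Y).
Proof.
move=> a U; rewrite nbhsE => -[V [oV Va] VU].
have [n nV] := pbase_nbhs oV Va.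
apply/nbhs_pointed_base; exists n.+1 => b /= ab.
by apply/VU/nV; rewrite (ab n)//; exact: pbase_point.
Qed.

Lemma outer_base_pointed_base (A : set Y) (y : Y) (b : nat -> set Y) :
    outer_base A b -> A y ->
  exists a : M, ppoint a = y.
Proof.
move=> [bo bA] Ay.
pose c n : set Y := if `[< b n y >] then b n else setT.
have co n : open (c n) by rewrite /c; case: asboolP => // _; exact: openT.
have cy n : c n y by rewrite /c; case: asboolP.
have cb U : open U -> U y -> exists n, c n `<=` U.
  move=> oU Uy; have [n ny nU] := bA y U Ay oU Uy.
  by exists n; rewrite /c asboolT.
by exists (PointedBase co cy cb).
Qed.

(** Given a base at [y], the first [n] terms of a sequence can be prolonged into
    a base at [y] as soon as they contain [y].  This is why [ppoint] is open. *)
Lemma pointed_base_extend (a : M) y n : (forall i, (i < n)%N -> a i y) ->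
  (exists b : M, ppoint b = y) -> exists2 b : M, ppoint b = y & agree n (a, b).
Proof.
move=> ay [b by_].
pose c i := if (i < n)%N then a i else b (i - n)%N.
have co i : open (c i) by rewrite /c; case: ifP => _; exact: pbase_open.
have cy i : c i y.
  by rewrite /c; case: ifP => [/ay//|_]; rewrite -by_; exact: pbase_point.
have cb U : open U -> U y -> exists i, c i `<=` U.
  rewrite -by_ => oU Uy; have [i iU] := pbase_nbhs oU Uy.
  by exists (n + i)%N; rewrite /c ltnNge leq_addr /= addKn.
by exists (PointedBase co cy cb) => // i /= ilt; rewrite /c ilt.
Qed.

Lemma ppoint_open :
  (forall y : Y, exists a : M, ppoint a = y) -> open_map (@ppoint Y).
Proof.
move=> Yb U; rewrite openE => oU; rewrite openE => _ [a /oU Ua <-].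
have [n nU] := (nbhs_pointed_base _ _).1 Ua.
have : nbhs (ppoint a) [set y | forall i, (i < n)%N -> a i y].
  elim: n {nU} => [|n IH]; first by near=> y.
  near=> y => i; rewrite ltnS leq_eqVlt => /predU1P[->|].
    near: y; apply: open_nbhs_nbhs; split; first exact: pbase_open.
    exact: pbase_point.
  by move: i; near: y.
apply: filterS => y ay; have [b <- ab] := pointed_base_extend ay (Yb y).
by exists b => //; exact: nU.
Unshelve. all: by end_near. Qed.

(** Let [b] be an outer base of the compact set [K].  The index [n] codes a pair
    [(i, j)], called good if the points of [K] in the closure of [b j] are in
    [b i].  For good [n], [K] is covered by two closed sets, [closure (b j)] and
    the complement of [b j], to which the open sets [b i] and [Y] are attached.
    If for every [n] a closed set containing [y] is chosen ([s n] tells which),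
    the attached open sets form a base at [y]: for [y] in [b i], a good pair
    [(i, j)] with [y] in [b j] leaves no choice but [b i].  The sequences
    obtained in this way form a compact set, because each term takes at most
    two values. *)
Lemma ppoint_compact_covering : hausdorff_space Y ->
    (forall A : set Y, compact A -> exists b, outer_base A b) ->
  compact_covering (@ppoint Y).
Proof.
move=> hY oY K cK; have [b [bo bK]] := oY K cK.
pose ij n : nat * nat := odflt (0, 0)%N (unpickle n).
pose good n := `[< K `&` closure (b (ij n).2) `<=` b (ij n).1 >].
pose D n (s : bool) : set Y := if good n then
  (if s then closure (b (ij n).2) else ~` b (ij n).2) else setT.
pose G n (s : bool) : set Y := if good n && s then b (ij n).1 else setT.
have Dc n s : closed (D n s).
  rewrite /D; case: ifP => _; last exact: closedT.
  by case: s; [exact: closed_closure | exact: open_closedC].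
have Go n s : open (G n s).
  by rewrite /G; case: ifP => _; [exact: bo | exact: openT].
have DG n s y : K y -> D n s y -> G n s y.
  rewrite /D /G; case: (boolP (good n)) => //= /asboolP gn Ky.
  by case: s => // Dy; exact: gn.
(* the attached open sets form a neighbourhood base at [y] *)
have GD (s : nat -> bool) y : K y -> (forall n, D n (s n) y) ->
    forall U, open U -> U y -> exists n, G n (s n) `<=` U.
  move=> Ky Ds U oU Uy; have [i iy iU] := bK y U Ky oU Uy.
  have cKi : compact (K `&` ~` b i).
    by apply: compact_closedI => //; exact: open_closedC.
  have [|V [oV Vy] KV] := compact_closure_avoid hY cKi (x := y).
    by case.
  have [j jy jV] := bK y V Ky oV Vy.
  have ijE : ij (pickle (i, j)) = (i, j) by rewrite /ij pickleK.
  have gn : good (pickle (i, j)).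
    apply/asboolP; rewrite ijE /= => z [Kz jz]; apply: contrapT => iz.
    by have : set0 z; [rewrite -KV; split => //; exact: closureS jz|].
  exists (pickle (i, j)); apply: subset_trans iU; move: (Ds (pickle (i, j))).
  by rewrite /D /G gn ijE /=; case: (s _) => [_|/(_ jy)].
pose L : set M := [set a | K (ppoint a) /\
  forall n, exists2 s, a n = G n s & D n s (ppoint a)].
exists L; last first.
  apply/seteqP; split => [_ [a [Ka _] <-] //|y Ky].
  pose s n := `[< b (ij n).2 y >].
  have Ds n : D n (s n) y.
    rewrite /D /s; case: ifP => // _; case: asboolP => //.
    exact: subset_closure.
  exists (PointedBase (fun n => Go n (s n)) (fun n => DG n (s n) y Ky (Ds n))
    (GD s y Ky Ds)) => //.
  by split => //= n; exists (s n).
(* an ultrafilter [F] on [L] fixes each choice [s n]; a cluster point [y] of its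
   image then lies in every chosen closed set, and [F] converges to the sequence
   of the choices [s], based at [y] *)
rewrite compact_ultra => F UF FL.
have FK : F (@ppoint Y @^-1` K) by apply: filterS FL => a [].
have [y [Ky Fy]] := cK (@ppoint Y @ F) _ FK.
have /choice[s sP] n :
    exists s, F [set a : M | a n = G n s /\ D n s (ppoint a)].
  have [Ft|Ff] := in_ultra_setVsetC
    [set a : M | a n = G n true /\ D n true (ppoint a)] UF.
    by exists true.
  exists false; apply: filterS (filterI FL Ff) => a.
  move=> [[Ka /(_ n)[[] an Da]] nt] //.
  by case: nt.
have Ds n : D n (s n) y.
  have FD : F (@ppoint Y @^-1` D n (s n)) by apply: filterS (sP n) => a [].
  by apply: Dc => V; exact: Fy.
pose a := PointedBase (fun n => Go n (s n))
  (fun n => DG n (s n) y Ky (Ds n)) (GD s y Ky Ds).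
exists a; split; first by split => //= n; exists (s n).
move=> U /nbhs_pointed_base[n nU]; apply: filterS nU _.
elim: n => [|n IH]; first by apply: filterS FL.
apply: filterS (filterI IH (sP n)) => c [ac [cn _]] i; rewrite ltnS leq_eqVlt.
by move=> /predU1P[->|/ac].
Qed.

End PointedBase.

Lemma outer_base_open_compact_covering_image (R : realType)
    (Y : topologicalType) :
    hausdorff_space Y ->
    (forall A : set Y, compact A -> exists b, outer_base A b) ->
  open_compact_covering_metric_image R Y.
Proof.
move=> hY oY.
have [M [f [g [cf cg fK gK]]]] := countable_uniformity_metrizable R
  (@pointed_base_countable_uniformity Y) (pointed_base_hausdorff hY).
have Yb (y : Y) : exists a : pointed_base Y, ppoint a = y.
  have [b ob] := oY _ (@compact_set1 _ y).
  exact: outer_base_pointed_base ob erefl.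
have gE (U : set M) : g @` U = f @^-1` U.
  apply/seteqP; split => [_ [x Ux <-]|a Ua]; first by rewrite /= gK.
  by exists (f a).
exists M, (@ppoint Y \o g); split.
- by move=> x; apply: continuous_comp; [exact: cg | exact: ppoint_continuous].
- move=> U oU; rewrite -image_comp gE; apply: ppoint_open => //.
  by move: U oU; apply/continuousP.
- move=> C /(ppoint_compact_covering hY oY)[K cK KC]; exists (f @` K).
    apply: continuous_compact => //; exact: continuous_subspaceT.
  by rewrite -KC image_comp; congr image; apply/funext => a /=; rewrite fK.
- by move=> y _; have [a <-] := Yb y; exists (f a); rewrite //= fK.
Qed.

(** * The equivalence *)

Theorem theorem3p5 (R : realType) (X : topologicalType)
    (X_regular : regular_space X) (X_T1 : accessible_space X) :
  [<-> open_compact_covering_metric_image R (compact_hyperspace X);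
       D0_space (compact_hyperspace X);
       D0_space (finite_hyperspace X);
       D0_space (hyperspace2 X);
       D0_space X /\ (forall A : set X, compact A -> metrizable R A)].
Proof.
tfae.
- exact: D0_compact_covering_image.
- by apply: D0_subset => H; exact: finite_compact.
- apply: D0_subset => H /card_le_finite; apply; exact: finite_II.
- move=> D0; split; first exact: D0_embedded (hyperpair_diag_embedded X_T1) D0.
  exact: D0_hyperspace2_metrizable.
- move=> [D0 mX]; apply: outer_base_open_compact_covering_image.
    by apply: hausdorff_sub; exact: hyperspace_hausdorff.
  apply: compact_hyperspace_outer_base => A cA.
  exact: D0_compact_outer_base (mX A cA).
Qed.
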